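(* Let $X_1,X_2$ be real vector spaces and $B:X_1\times X_1\to X_2$ a bilinear map. Then the set $X_1\times X_2$ equipped with the product $$(a,r)*_B(\tilde a,\tilde r)=(a+\tilde a,\;r+\tilde r+B(a,\tilde a))$$ is a group. Suppose moreover that $X_1,X_2$ are equipped with norms and that $B$ is bounded with respect to these norms with operator norm $\|B\|\le2$, i.e. $\|B(a,\tilde a)\|_{X_2}\le2\|a\|_{X_1}\|\tilde a\|_{X_1}$ for all $a,\tilde a\in X_1$. Then $$\|(a,r)\|=\max\big(\|a\|_{X_1},\|r\|_{X_2}^{1/2}\big)$$ is subadditive in the sense that $\|w*_B\tilde w\|\le\|w\|+\|\tilde w\|$ for all $w,\tilde w\in X_1\times X_2$. *)

(* Defs.v *)
From mathcomp Require Import all_boot all_order all_algebra.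
From mathcomp Require Import reals normedtype.

Set Implicit Arguments.
Unset Strict Implicit.
Unset Printing Implicit Defensive.

Import Order.TTheory GRing.Theory Num.Theory.
Import numFieldNormedType.Exports.

Local Open Scope ring_scope.

(* The conjuncts are the fields of MathComp's factory [isGroup]. Here [T] is
   left without any canonical structure because the product of two modules
   already carries another group law, namely its addition. *)
Definition is_group_law (T : Type) (op : T -> T -> T) : Prop :=
  exists (e : T) (inv : T -> T),
    [/\ associative op, left_id e op, right_id e op,
        left_inverse e inv op & right_inverse e inv op].

Definition mulB (R : realType) (X1 X2 : lmodType R)
    (B : {bilinear X1 -> X1 -> X2}) (w w' : X1 * X2) : X1 * X2 :=
  (w.1 + w'.1, w.2 + w'.2 + B w.1 w'.1).

(* Not the norm `|w| that the library puts on the product, which has no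
   square root. *)
Definition hnorm (R : realType) (X1 X2 : normedModType R) (w : X1 * X2) : R :=
  Num.max `|w.1| (Num.sqrt `|w.2|).

(* Main.v *)
Require Import Defs.
From mathcomp Require Import all_boot all_order all_algebra.
From mathcomp Require Import reals normedtype.

(** The first components add, so they obey the axioms of an additive group.
    In the second component the term [B w.1 w'.1] is a 2-cocycle: additivity of
    [B] in each variable makes both bracketings of a triple product contribute
    [B a b + B a c + B b c], and makes the term vanish when one factor is the
    unit [(0, 0)].

    For [t >= 0], the dilation [(a, r) -> (t a, t^2 r)] multiplies [hnorm] by
    [t], so the second component should be compared with a square. If [N] and
    [N'] are the norms of the two factors, the second component of the product
    has norm at most [N^2 + N'^2 + 2 N N' = (N + N')^2]: the bound 2 on [B] is
    exactly the coefficient of the cross term. *)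

Import Order.TTheory GRing.Theory Num.Theory.
Import numFieldNormedType.Exports.

Local Open Scope ring_scope.

Lemma mulB_is_group_law (R : realType) (X1 X2 : lmodType R)
    (B : {bilinear X1 -> X1 -> X2}) : is_group_law (mulB B).
Proof.
(* The second component of the inverse solves r + s + B a (- a) = 0 for s. *)
exists (0, 0), (fun w => (- w.1, - w.2 + B w.1 w.1)).
split=> [[a r] [b s] [c t]|[a r]|[a r]|[a r]|[a r]]; rewrite /mulB /=.
- congr (_, _); first exact: addrA.
  by rewrite linearDl linearDr !addrA (ACl (1*2*5*3*6*4)).
- by rewrite linear0l !add0r addr0.
- by rewrite linear0r !addr0.
- by rewrite linearNl addNr addrAC addrK addNr.
- by rewrite linearNr subrr addrA subrr add0r subrr.
Qed.

(** Membership in a ball for [hnorm], with the square root cleared. Squaring is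
    harmless because the bound on the first component makes [N] nonnegative. *)
Lemma hnorm_le {R : realType} {X1 X2 : normedModType R} (w : X1 * X2) (N : R) :
  (hnorm w <= N) = (`|w.1| <= N) && (`|w.2| <= N ^+ 2).
Proof.
rewrite /hnorm ge_max; apply: andb_id2l => aN.
have N0 : 0 <= N by apply: le_trans aN.
by rewrite -{1}(ger0_norm N0) -sqrtr_sqr ler_sqrt // sqr_ge0.
Qed.

Lemma hnorm_mulB {R : realType} {X1 X2 : normedModType R}
    (B : {bilinear X1 -> X1 -> X2}) (w w' : X1 * X2) :
  (forall a a' : X1, `|B a a'| <= 2 * `|a| * `|a'|) ->
  hnorm (mulB B w w') <= hnorm w + hnorm w'.
Proof.
move=> B2.
have /andP[aN rN] : (`|w.1| <= hnorm w) && (`|w.2| <= hnorm w ^+ 2).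
  by rewrite -hnorm_le.
have /andP[aN' rN'] : (`|w'.1| <= hnorm w') && (`|w'.2| <= hnorm w' ^+ 2).
  by rewrite -hnorm_le.
rewrite hnorm_le /=; apply/andP; split.
  by apply: le_trans (ler_normD _ _) _; apply: lerD.
have BN : `|B w.1 w'.1| <= hnorm w * hnorm w' *+ 2.
  apply: le_trans (B2 _ _) _.
  by rewrite -mulrA mulr_natl lerMn2r ler_pM.
apply: le_trans (ler_normD _ _) _.
rewrite sqrrD addrAC lerD //.
by apply: le_trans (ler_normD _ _) _; apply: lerD.
Qed.

Theorem lemma3p5 (R : realType) :
  (forall (X1 X2 : lmodType R) (B : {bilinear X1 -> X1 -> X2}),
      is_group_law (mulB B)) /\
  (forall (X1 X2 : normedModType R) (B : {bilinear X1 -> X1 -> X2}),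
      (forall a a' : X1, `|B a a'| <= 2 * `|a| * `|a'|) ->
      forall w w' : X1 * X2,
        hnorm (mulB B w w') <= hnorm w + hnorm w').
Proof.
split=> [X1 X2 B|X1 X2 B B2 w w']; first exact: mulB_is_group_law.
exact: hnorm_mulB.
Qed.
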